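(* For every $f\in\mathcal E$, the sequence $(T^nf)_{n\in\mathbb N}$ converges uniformly on $[0,1]$ to $h$.
   Context: ''Decreasing'' means non-increasing; $\int f:=\int_0^1 f(x)\,dx$. Let $\mathcal M$ be the set of measurable $f\colon[0,1]\to[0,\infty)$ with $\int f>0$, and $\mathcal E$ the set of decreasing $f\in\mathcal M$ with $f(0)=1$. For $g\in\mathcal E$ its pseudo-inverse is $g^*(y):=\sup\{x\in[0,1]: g(x)\ge y\}$ for $y\in[0,1]$; then $g^*\in\mathcal E$ and $\int g^*=\int g$. For $g\in\mathcal M$ put $(Ig)(x):=\int_x^1 g/\int g$. Define the operator $T$ on $\mathcal E$ by $Tf:=I(f^* )$, i.e. $(Tf)(x)=\frac{\int_x^1 f^*}{\int f}$ for $x\in[0,1]$, with iterates $T^0=\mathrm{id}$, $T^n=T\circ T^{n-1}$. Let $h_0\equiv 1$ on $[0,1]$ and $h_n:=T^nh_0$. The sequence $(h_n)$ converges uniformly on $[0,1]$; let $h$ denote its limit (a continuous, strictly decreasing function with $h(0)=1$, $h(1)=0$, satisfying $Th=h$). *)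

(* Defs.v *)
From Stdlib Require Import Reals.
From Coquelicot Require Import Coquelicot.
Open Scope R_scope.

(* All functions are R -> R but only their values on [0,1] matter. *)

(* integral over [a,b] (Riemann; all functions used below are monotone and
   bounded on [0,1], hence Riemann = Lebesgue integrable) *)

Definition inE (f : R -> R) : Prop :=
  (forall x, 0 <= x <= 1 -> 0 <= f x) /\
  (forall x y, 0 <= x -> x <= y -> y <= 1 -> f y <= f x) /\
  f 0 = 1 /\
  0 < RInt f 0 1.

Definition pinv (g : R -> R) : R -> R :=
  fun y => real (Lub_Rbar (fun x => 0 <= x <= 1 /\ y <= g x)).

Definition Iop (g : R -> R) : R -> R :=
  fun x => RInt g x 1 / RInt g 0 1.

Definition Top (f : R -> R) : R -> R := Iop (pinv f).

Definition h0 : R -> R := fun _ => 1.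

Definition unif_conv01 (u : nat -> R -> R) (l : R -> R) : Prop :=
  forall eps : R, 0 < eps -> exists N : nat, forall n : nat, (N <= n)%nat ->
    forall x : R, 0 <= x <= 1 -> Rabs (u n x - l x) < eps.

(* Main.v *)
Require Import Defs.
From Stdlib Require Import Reals Lra Lia Classical.
From Coquelicot Require Import Coquelicot.
Open Scope R_scope.

(** Write [f_n = T^n f], [h_n = T^n h0]. For all [lam, C > 0] the function
    [x |-> f_n (lam x) - C h_n x] never takes the signs -, +, - in this order:
    pseudo-inversion reverses the sign pattern (exchanging [lam] and [C]), and
    integration from the right cannot create new sign changes. As both
    functions are [1] at [0], taking [C] close to [1] gives [f_n <= h_n], and,
    with [q_n] the quotient of the integrals of [f_n^*] and [h_n^*],
    [f_(n+1) (q_n x) >= h_(n+1) x] by comparing slopes at [0]. Hence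
    [f_(n+1)^* >= q_n h_(n+1)^*], so [q_n] increases, is at most [1], and
    [(q_n / q_(n+1)) h_(n+2) <= f_(n+2) <= h_(n+2)], where the factor
    tends to [1]. *)

(** * Bounds and monotonicity of the pseudo-inverse *)

Lemma pinv_ge (g : R -> R) (x y : R) :
  0 <= x <= 1 -> y <= g x -> x <= pinv g y.
Proof.
  intros Hx Hy; unfold pinv.
  set (E := fun x => 0 <= x <= 1 /\ y <= g x).
  destruct (Lub_Rbar_correct E) as [Hub Hlub].
  assert (H1 := Hub x (conj Hx Hy)).
  assert (H2 : Rbar_le (Lub_Rbar E) 1)
    by (apply Hlub; intros z [Hz _]; simpl; lra).
  destruct (Lub_Rbar E); simpl in *; tauto.
Qed.

(** The hypothesis [0 <= l] covers an empty superlevel set, whose supremum [m_infty] has real part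
    [0]. *)
Lemma pinv_le (g : R -> R) (y l : R) :
  0 <= l -> (forall x, 0 <= x <= 1 -> y <= g x -> x <= l) -> pinv g y <= l.
Proof.
  intros Hl H; unfold pinv.
  set (E := fun x => 0 <= x <= 1 /\ y <= g x).
  destruct (Lub_Rbar_correct E) as [_ Hlub].
  assert (H1 : Rbar_le (Lub_Rbar E) l)
    by (apply Hlub; intros z [Hz Hy]; simpl; auto).
  destruct (Lub_Rbar E); simpl in *; tauto.
Qed.

Lemma pinv_nonneg (g : R -> R) (y : R) : 0 <= pinv g y.
Proof.
  destruct (classic (exists x, 0 <= x <= 1 /\ y <= g x)) as [[x [Hx Hy]]|Hno].
  - generalize (pinv_ge g x y Hx Hy); lra.
  - unfold pinv; replace (Lub_Rbar _) with m_infty; [simpl; lra|].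
    symmetry; apply is_lub_Rbar_unique; split.
    + intros x Hx; elim Hno; now exists x.
    + now intros b _.
Qed.

Lemma pinv_le_1 (g : R -> R) (y : R) : pinv g y <= 1.
Proof. apply pinv_le; intros; lra. Qed.

Lemma pinv_antitone (g : R -> R) (y z : R) : y <= z -> pinv g z <= pinv g y.
Proof.
  intros H; apply pinv_le; [apply pinv_nonneg|].
  intros x Hx Hz; apply pinv_ge; lra.
Qed.

Lemma pinv_eq_0 (g : R -> R) (y : R) :
  (forall x, 0 <= x <= 1 -> g x < y) -> pinv g y = 0.
Proof.
  intros H; apply Rle_antisym; [|apply pinv_nonneg].
  apply pinv_le; [lra|]; intros x Hx Hy; specialize (H x Hx); lra.
Qed.

Lemma pinv_lt_above (g : R -> R) (x y : R) :
  0 <= x <= 1 -> pinv g y < x -> g x < y.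
Proof.
  intros Hx H; destruct (Rlt_le_dec (g x) y) as [|Hy]; [assumption|].
  generalize (pinv_ge g x y Hx Hy); lra.
Qed.

(** * Riemann integrability of decreasing functions *)

Lemma ex_RInt_threshold (f : R -> R) (a b c : R) :
  a <= b -> (forall x y, x <= y -> f y <= f x) ->
  ex_RInt (fun x => if Rle_dec c (f x) then 1 else 0) a b.
Proof.
  intros Hab Hf.
  set (F := fun x => if Rle_dec c (f x) then 1 else 0).
  (* The integrand is [1] before the supremum [s] and [0] after it; adding the point [a] keeps the
     set nonempty. *)
  destruct (completeness (fun x => x = a \/ (a <= x <= b /\ c <= f x)))
    as [s [Hub Hlub]].
  { exists b; intros x [->|[Hx _]]; lra. }
  { exists a; now left. }
  assert (Has : a <= s) by (apply Hub; now left).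
  assert (Hsb : s <= b) by (apply Hlub; intros x [->|[Hx _]]; lra).
  apply ex_RInt_Chasles with s.
  - apply ex_RInt_ext with (fun _ => 1); [|apply ex_RInt_const].
    rewrite Rmin_left, Rmax_right by assumption.
    intros x Hx; unfold F; destruct (Rle_dec c (f x)) as [|Hc]; [reflexivity|].
    exfalso; enough (s <= x) by lra.
    apply Hlub; intros z [->|[Hz Hcz]]; [lra|].
    destruct (Rle_lt_dec z x) as [|Hxz]; [assumption|].
    generalize (Hf x z); lra.
  - apply ex_RInt_ext with (fun _ => 0); [|apply ex_RInt_const].
    rewrite Rmin_left, Rmax_right by assumption.
    intros x Hx; unfold F; destruct (Rle_dec c (f x)) as [Hc|]; [|reflexivity].
    exfalso; enough (x <= s) by lra.
    apply Hub; right; lra.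
Qed.

(** This is [f] rounded down to multiples of [1/(N+1)] and capped at [(n+1)/(N+1)], written as a sum
    of indicators of superlevel sets. *)
Definition staircase (f : R -> R) (N n : nat) (x : R) : R :=
  sum_f_R0 (fun k => / INR (S N) *
              (if Rle_dec (INR (S k) / INR (S N)) (f x) then 1 else 0)) n.

Lemma ex_RInt_staircase (f : R -> R) (a b : R) (N n : nat) :
  a <= b -> (forall x y, x <= y -> f y <= f x) ->
  ex_RInt (staircase f N n) a b.
Proof.
  intros Hab Hf; unfold staircase; induction n as [|n IH]; simpl.
  - apply (@ex_RInt_scal R_NormedModule).
    now apply (ex_RInt_threshold f a b).
  - apply (@ex_RInt_plus R_NormedModule); [exact IH|].
    apply (@ex_RInt_scal R_NormedModule).
    now apply (ex_RInt_threshold f a b).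
Qed.

(** The second clause drives the induction: once [f x] reaches the cap, every layer is counted. *)
Lemma staircase_bounds (f : R -> R) (N n : nat) (x : R) :
  0 <= f x ->
  (f x < INR (S (S n)) / INR (S N) -> f x - / INR (S N) <= staircase f N n x) /\
  (INR (S n) / INR (S N) <= f x -> INR (S n) / INR (S N) <= staircase f N n x) /\
  staircase f N n x <= f x /\ staircase f N n x <= INR (S n) / INR (S N).
Proof.
  intros H0.
  assert (HN : 0 < / INR (S N)) by (apply Rinv_0_lt_compat, lt_0_INR; lia).
  unfold staircase, Rdiv; set (e := / INR (S N)) in *.
  induction n as [|n IH].
  - simpl sum_f_R0.
    change (INR 2) with 2; change (INR 1) with 1.
    destruct (Rle_dec (1 * e) (f x)); lra.
  - rewrite tech5.
    set (s := sum_f_R0 _ n) in *.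
    rewrite (S_INR (S (S n))).
    pose proof (S_INR (S n)) as E.
    set (m := INR (S (S n))) in *; rewrite E in *.
    destruct IH as [I1 [I2 [I3 I4]]].
    destruct (Rle_dec _ _) as [Hd|Hd]; repeat split; intros; nra.
Qed.

(** [f] is the uniform limit of its staircases, with error at most [1/(N+1)]. *)
Lemma ex_RInt_antitone (f : R -> R) (a b : R) :
  (forall x, 0 <= f x <= 1) -> (forall x y, x <= y -> f y <= f x) ->
  ex_RInt f a b.
Proof.
  intros Hb Hf.
  assert (H : forall a b, a <= b -> ex_RInt f a b).
  { clear a b; intros a b Hab.
    destruct (filterlim_RInt (fun N => staircase f N N) a b eventually _ f
                (fun N => RInt (staircase f N N) a b)) as [I [_ HI]].
    - intros N; apply (@RInt_correct R_CompleteNormedModule).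
      now apply ex_RInt_staircase.
    - intros P [eps HP].
      destruct (archimed_cor1 eps (cond_pos eps)) as [N0 [HN0 HN0p]].
      exists N0; intros N HN; apply HP; intros x.
      assert (Hle : / INR (S N) <= / INR N0).
      { apply Rinv_le_contravar; [now apply lt_0_INR|apply le_INR; lia]. }
      destruct (staircase_bounds f N N x (proj1 (Hb x))) as [H1 [_ [H2 _]]].
      assert (HS : 0 < INR (S N)) by (apply lt_0_INR; lia).
      assert (H3 : f x < INR (S (S N)) / INR (S N)).
      { apply Rle_lt_trans with 1; [apply Hb|].
        apply Rlt_div_r; [lra|]; rewrite (S_INR (S N)); lra. }
      specialize (H1 H3).
      change (Rabs (staircase f N N x - f x) < eps).
      apply Rabs_def1; lra.
    - now exists I. }
  destruct (Rle_lt_dec a b); [now apply H|].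
  apply ex_RInt_swap, H; lra.
Qed.

(** * Integrals of pseudo-inverses *)

Lemma ex_RInt_pinv (g : R -> R) (a b : R) : ex_RInt (pinv g) a b.
Proof.
  apply ex_RInt_antitone; [|apply pinv_antitone].
  intros x; split; [apply pinv_nonneg|apply pinv_le_1].
Qed.

Lemma RInt_pinv_bounds (g : R -> R) (x y : R) : x <= y ->
  pinv g y * (y - x) <= RInt (pinv g) x y <= pinv g x * (y - x).
Proof.
  intros Hxy.
  assert (E : forall c, RInt (fun _ : R => c) x y = c * (y - x)).
  { intros c; rewrite RInt_const; unfold scal; simpl; unfold mult; simpl; ring. }
  split.
  - rewrite <- (E (pinv g y)).
    apply RInt_le; [assumption|apply ex_RInt_const|apply ex_RInt_pinv|].
    intros z Hz; apply pinv_antitone; lra.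
  - rewrite <- (E (pinv g x)).
    apply RInt_le; [assumption|apply ex_RInt_pinv|apply ex_RInt_const|].
    intros z Hz; apply pinv_antitone; lra.
Qed.

Lemma RInt_pinv_nonneg (g : R -> R) (x y : R) :
  x <= y -> 0 <= RInt (pinv g) x y.
Proof.
  intros Hxy; destruct (RInt_pinv_bounds g x y Hxy) as [H _].
  generalize (pinv_nonneg g y); nra.
Qed.

Lemma RInt_pinv_Chasles (g : R -> R) (x y z : R) :
  RInt (pinv g) x y + RInt (pinv g) y z = RInt (pinv g) x z.
Proof. apply (@RInt_Chasles R_CompleteNormedModule); apply ex_RInt_pinv. Qed.

Lemma RInt_pinv_pos (g : R -> R) (y : R) :
  0 < y <= 1 -> 0 < pinv g y -> 0 < RInt (pinv g) 0 1.
Proof.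
  intros Hy Hp; rewrite <- (RInt_pinv_Chasles g 0 y 1).
  generalize (RInt_pinv_nonneg g y 1); intros H1.
  destruct (RInt_pinv_bounds g 0 y) as [H2 _]; nra.
Qed.

(** Replaces the mean value theorem for integrands that may be discontinuous. *)
Lemma RInt_lt_witness (f g : R -> R) (a b : R) :
  a <= b -> ex_RInt f a b -> ex_RInt g a b -> RInt f a b < RInt g a b ->
  exists t, a < t < b /\ f t < g t.
Proof.
  intros Hab Hf Hg H; apply NNPP; intros Hno.
  apply (Rlt_not_le _ _ H), RInt_le; try assumption.
  intros t Ht; apply Rnot_lt_le; intros Hlt; apply Hno; now exists t.
Qed.

(** * Lipschitz profiles and the operator [Top] *)

(** The regularity gained by one application of [Top]. It is stated on the whole line because scaled
    arguments [lam * x] leave [[0,1]]. *)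
Definition profile (u : R -> R) : Prop :=
  u 0 = 1 /\ (forall x, 1 <= x -> u x = 0) /\
  (forall x y, x <= y -> u y <= u x) /\
  exists L, 0 < L /\ forall x y, x <= y -> u x - u y <= L * (y - x).

Lemma Top_sub (g : R -> R) (x y : R) :
  Top g x - Top g y = RInt (pinv g) x y / RInt (pinv g) 0 1.
Proof.
  unfold Top, Iop; rewrite <- (RInt_pinv_Chasles g x y 1); unfold Rdiv; ring.
Qed.

(* Beyond [1] the pseudo-inverse is the supremum of the empty set, whose real
   part is [0]; so [Top g] extends by [0]. *)
Lemma Top_ge_1 (g : R -> R) (x : R) :
  (forall z, 0 <= z <= 1 -> g z <= 1) -> 1 <= x -> Top g x = 0.
Proof.
  intros Hg Hx; unfold Top, Iop.
  rewrite (RInt_ext _ (fun _ => 0)).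
  - rewrite RInt_const; unfold scal; simpl; unfold mult; simpl.
    unfold Rdiv; ring.
  - rewrite Rmin_right, Rmax_left by assumption.
    intros y Hy; apply pinv_eq_0; intros z Hz; specialize (Hg z Hz); lra.
Qed.

Lemma Top_0 (g : R -> R) : 0 < RInt (pinv g) 0 1 -> Top g 0 = 1.
Proof. intros H; unfold Top, Iop; field; lra. Qed.

Lemma profile_Top (g : R -> R) :
  (forall x, 0 <= x <= 1 -> g x <= 1) -> 0 < RInt (pinv g) 0 1 ->
  profile (Top g).
Proof.
  intros Hg HA; split; [|split; [|split]].
  - now apply Top_0.
  - intros x; now apply Top_ge_1.
  - intros x y Hxy.
    assert (0 <= Top g x - Top g y); [|lra].
    rewrite Top_sub; apply Rdiv_le_0_compat; [|assumption].
    now apply RInt_pinv_nonneg.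
  - exists (/ RInt (pinv g) 0 1); split; [now apply Rinv_0_lt_compat|].
    intros x y Hxy; rewrite Top_sub; unfold Rdiv; rewrite Rmult_comm.
    apply Rmult_le_compat_l; [left; now apply Rinv_0_lt_compat|].
    destruct (RInt_pinv_bounds g x y Hxy) as [_ H].
    generalize (pinv_le_1 g x); nra.
Qed.

Lemma profile_nonneg (u : R -> R) (x : R) : profile u -> 0 <= u x.
Proof.
  intros (_ & H1 & Hm & _); destruct (Rle_lt_dec 1 x).
  - rewrite H1; lra.
  - rewrite <- (H1 1); [apply Hm|]; lra.
Qed.

Lemma profile_le_1 (u : R -> R) (x : R) : profile u -> 0 <= x -> u x <= 1.
Proof. intros (H0 & _ & Hm & _) Hx; rewrite <- H0; now apply Hm. Qed.

(** By continuity the supremum is attained: if [u s < y], the Lipschitz bound keeps [u] below [y] on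
    an interval to the left of [s] as well. *)
Lemma profile_pinv_attained (u : R -> R) (y : R) :
  profile u -> y <= 1 -> y <= u (pinv u y).
Proof.
  intros (H0 & H1 & Hm & L & HL & Hlip) Hy.
  apply Rnot_lt_le; intros Hlt.
  set (s := pinv u y) in *.
  pose (d := (y - u s) / L).
  assert (Hd : 0 < d) by (apply Rdiv_lt_0_compat; lra).
  assert (Ed : L * d = y - u s) by (unfold d; field; lra).
  assert (Hs : s <= Rmax 0 (s - d / 2)).
  { apply pinv_le; [apply Rmax_l|].
    intros x Hx Hyx; apply Rle_trans with (2 := Rmax_r _ _).
    apply Rnot_lt_le; intros Hlt2.
    destruct (Rle_lt_dec x s) as [Hxs|Hxs].
    - specialize (Hlip x s Hxs); nra.
    - specialize (Hm s x); lra. }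
  revert Hs; unfold Rmax; destruct (Rle_dec 0 (s - d / 2)); [lra|].
  intros Hs; assert (s = 0) by (generalize (pinv_nonneg u y); fold s; lra).
  rewrite H in *; lra.
Qed.

Lemma profile_pinv_pos (u : R -> R) (y : R) :
  profile u -> y < 1 -> 0 < pinv u y.
Proof.
  intros (H0 & H1 & Hm & L & HL & Hlip) Hy.
  set (d := Rmin 1 ((1 - y) / L)).
  assert (Hq : 0 < (1 - y) / L) by (apply Rdiv_lt_0_compat; lra).
  assert (Hd : 0 < d) by (apply Rmin_glb_lt; lra).
  apply Rlt_le_trans with d; [assumption|].
  apply pinv_ge; [split; [lra|apply Rmin_l]|].
  assert (L * d <= L * ((1 - y) / L))
    by (apply Rmult_le_compat_l; [lra|apply Rmin_r]).
  replace (L * ((1 - y) / L)) with (1 - y) in H by (field; lra).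
  specialize (Hlip 0 d); lra.
Qed.

Lemma profile_RInt_pinv_pos (u : R -> R) :
  profile u -> 0 < RInt (pinv u) 0 1.
Proof.
  intros Hu; apply RInt_pinv_pos with (1 / 2); [lra|].
  apply profile_pinv_pos; [assumption|lra].
Qed.

Lemma Top_pos (g : R -> R) (x : R) :
  0 < RInt (pinv g) 0 1 -> (forall y, y < 1 -> 0 < pinv g y) ->
  x < 1 -> 0 < Top g x.
Proof.
  intros HA Hp Hx; unfold Top, Iop; apply Rdiv_lt_0_compat; [|assumption].
  rewrite <- (RInt_pinv_Chasles g x ((x + 1) / 2) 1).
  generalize (RInt_pinv_nonneg g ((x + 1) / 2) 1); intros H1.
  destruct (RInt_pinv_bounds g x ((x + 1) / 2)) as [H2 _]; [lra|].
  specialize (Hp ((x + 1) / 2)); nra.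
Qed.

(** * Sign patterns under pseudo-inversion and integration *)

(* [D] is [Rle 0] for profiles but [Rlt 0] for pseudo-inverses, because
   [pinv u 0 = 1] even if [u] vanishes before [1]. *)
Definition no_dip_rise_dip (D : R -> Prop) (u v : R -> R) : Prop :=
  forall lam C x1 x2 x3, 0 < lam -> 0 < C -> D x1 -> x1 < x2 -> x2 < x3 ->
    u (lam * x1) < C * v x1 -> C * v x2 < u (lam * x2) ->
    u (lam * x3) < C * v x3 -> False.

(* Of two decreasing graphs, the upper one is also the one on the right. *)
Lemma no_dip_rise_dip_pinv (u v : R -> R) : profile u -> profile v ->
  no_dip_rise_dip (Rle 0) u v -> no_dip_rise_dip (Rlt 0) (pinv u) (pinv v).
Proof.
  intros Hu Hv H lam C y1 y2 y3 Hlam HC Hy1 H12 H23 D1 D2 D3.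
  assert (Hz : forall w y, profile w -> 1 < y -> pinv w y = 0).
  { intros w y Hw Hy; apply pinv_eq_0; intros x Hx.
    generalize (profile_le_1 w x Hw); lra. }
  assert (Hy3 : y3 <= 1).
  { apply Rnot_lt_le; intros Hgt; rewrite (Hz v y3) in D3 by assumption.
    generalize (pinv_nonneg u (lam * y3)); lra. }
  assert (Hly2 : lam * y2 <= 1).
  { apply Rnot_lt_le; intros Hgt; rewrite (Hz u (lam * y2)) in D2 by assumption.
    generalize (pinv_nonneg v y2); nra. }
  (* A dip of the pseudo-inverses at height [y] becomes a dip of the profiles at abscissa
     [pinv v y], with [lam] and [C] exchanged. *)
  assert (Hdip : forall y, 0 < y <= 1 -> pinv u (lam * y) < C * pinv v y ->
            u (C * pinv v y) < lam * v (pinv v y)).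
  { intros y Hy HD.
    assert (Hv1 := profile_pinv_attained v y Hv (proj2 Hy)).
    apply Rlt_le_trans with (lam * y); [|nra].
    destruct (Rle_lt_dec (C * pinv v y) 1).
    - apply pinv_lt_above; [|assumption].
      generalize (pinv_nonneg u (lam * y)); lra.
    - destruct Hu as (_ & Hu1 & _); rewrite Hu1; nra. }
  (* The rise is carried to the abscissa that [C] scales to [pinv u (lam * y2)], where [u] is still
     at least [lam * y2]. *)
  assert (Ex : C * (pinv u (lam * y2) / C) = pinv u (lam * y2))
    by (field; lra).
  set (x2 := pinv u (lam * y2) / C) in *.
  assert (Hx2 : pinv v y2 < x2) by nra.
  (* Pseudo-inversion reverses order, so the dip coming from [y3] is now the first. *)
  apply (H C lam (pinv v y3) x2 (pinv v y1)); try assumption.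
  - apply pinv_nonneg.
  - generalize (pinv_antitone v y2 y3); lra.
  - generalize (pinv_antitone u (lam * y1) (lam * y2)); nra.
  - apply Hdip; [lra|assumption].
  - rewrite Ex.
    apply Rlt_le_trans with (lam * y2); [|now apply profile_pinv_attained].
    apply Rmult_lt_compat_l; [assumption|].
    destruct (Rle_lt_dec x2 1).
    + apply pinv_lt_above; [|assumption].
      generalize (pinv_nonneg v y2); lra.
    + destruct Hv as (_ & Hv1 & _); rewrite Hv1; lra.
  - apply Hdip; [lra|assumption].
Qed.

(** Linear substitution in the integral that defines [Top g]. *)
Lemma Top_scaled_sub (g : R -> R) (lam x y : R) :
  ex_RInt (fun t => lam / RInt (pinv g) 0 1 * pinv g (lam * t)) x y /\
  Top g (lam * x) - Top g (lam * y) =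
  RInt (fun t => lam / RInt (pinv g) 0 1 * pinv g (lam * t)) x y.
Proof.
  set (A := RInt (pinv g) 0 1).
  assert (H : is_RInt (fun t => lam / A * pinv g (lam * t)) x y
                (Top g (lam * x) - Top g (lam * y))).
  { rewrite Top_sub; fold A.
    apply is_RInt_ext with
      (fun t => scal (/ A) (scal lam (pinv g (lam * t + 0)))).
    { intros t _; unfold scal; simpl; unfold mult; simpl.
      rewrite Rplus_0_r; unfold Rdiv; ring. }
    replace (RInt (pinv g) (lam * x) (lam * y) / A)
      with (scal (/ A) (RInt (pinv g) (lam * x) (lam * y)))
      by (unfold scal; simpl; unfold mult; simpl; unfold Rdiv; ring).
    apply (@is_RInt_scal R_NormedModule).
    apply (@is_RInt_comp_lin R_NormedModule).
    rewrite !Rplus_0_r.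
    apply (@RInt_correct R_CompleteNormedModule), ex_RInt_pinv. }
  split; [now exists (Top g (lam * x) - Top g (lam * y))|].
  symmetry; now apply is_RInt_unique.
Qed.

(** Signs -, +, - of the difference, followed by a common zero [M], force increments of signs +, -,
    +. The integrands are minus the slopes, so they show -, +, - at three interior points. *)
Lemma no_dip_rise_dip_Top (f g : R -> R) :
  profile (Top f) -> profile (Top g) ->
  0 < RInt (pinv f) 0 1 -> 0 < RInt (pinv g) 0 1 ->
  no_dip_rise_dip (Rlt 0) (pinv f) (pinv g) ->
  no_dip_rise_dip (Rle 0) (Top f) (Top g).
Proof.
  intros Hf Hg HA HB H lam C x1 x2 x3 Hlam HC Hx1 H12 H23 D1 D2 D3.
  set (A := RInt (pinv f) 0 1) in *; set (B := RInt (pinv g) 0 1) in *.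
  set (a := fun t => lam / A * pinv f (lam * t)).
  set (b := fun t => C * (1 / B * pinv g (1 * t))).
  assert (Ha : forall x y, ex_RInt a x y /\
            RInt a x y = Top f (lam * x) - Top f (lam * y)).
  { intros x y; destruct (Top_scaled_sub f lam x y); split; auto. }
  assert (Hb : forall x y, ex_RInt b x y /\
            RInt b x y = C * (Top g x - Top g y)).
  { intros x y; destruct (Top_scaled_sub g 1 x y) as [E1 E2]; split.
    - now apply (@ex_RInt_scal R_NormedModule).
    - rewrite !Rmult_1_l in E2; rewrite E2; unfold b.
      now apply (@RInt_scal R_CompleteNormedModule). }
  assert (Hx3 : x3 < 1).
  { apply Rnot_le_lt; intros Hge.
    rewrite (proj1 (proj2 Hg) x3 Hge) in D3.
    generalize (profile_nonneg _ (lam * x3) Hf); lra. }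
  (* Both [M] and [lam * M] are at least [1], so both functions vanish there. *)
  set (M := 1 + / lam).
  assert (Hil : 0 < / lam) by now apply Rinv_0_lt_compat.
  assert (HM1 : Top f (lam * M) = 0).
  { apply (proj1 (proj2 Hf)); unfold M.
    replace (lam * (1 + / lam)) with (lam + 1) by (field; lra); lra. }
  assert (HM2 : Top g M = 0) by (apply (proj1 (proj2 Hg)); unfold M; lra).
  destruct (RInt_lt_witness a b x1 x2) as [t1 [Ht1 K1]];
    [lra|apply Ha|apply Hb|rewrite (proj2 (Ha _ _)), (proj2 (Hb _ _)); lra|].
  destruct (RInt_lt_witness b a x2 x3) as [t2 [Ht2 K2]];
    [lra|apply Hb|apply Ha|rewrite (proj2 (Ha _ _)), (proj2 (Hb _ _)); lra|].
  destruct (RInt_lt_witness a b x3 M) as [t3 [Ht3 K3]];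
    [unfold M; lra|apply Ha|apply Hb
    |rewrite (proj2 (Ha _ _)), (proj2 (Hb _ _)), HM1, HM2; lra|].
  assert (Hk : 0 < lam / A) by now apply Rdiv_lt_0_compat.
  (* Dividing both integrands by [lam / A] leaves this as the new factor of [pinv g]. *)
  assert (HC' : 0 < C / B / (lam / A)).
  { apply Rdiv_lt_0_compat; [now apply Rdiv_lt_0_compat|assumption]. }
  assert (Eb : forall t, b t = lam / A * (C / B / (lam / A) * pinv g t)).
  { intros t; unfold b; rewrite Rmult_1_l; field; lra. }
  rewrite Eb in K1, K2, K3; unfold a in K1, K2, K3.
  apply (H lam (C / B / (lam / A)) t1 t2 t3); try lra;
    apply Rmult_lt_reg_l with (lam / A); assumption.
Qed.

(** * Pointwise comparison from the sign pattern *)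

(* Since both profiles equal [1] at [0], a factor [C] slightly above [1]
   creates the first dip there. *)
Lemma no_rise_dip (u v : R -> R) (lam x2 x3 : R) :
  profile u -> profile v -> no_dip_rise_dip (Rle 0) u v ->
  0 < lam -> 0 < x2 < x3 ->
  v x2 < u (lam * x2) -> v x3 <= u (lam * x3).
Proof.
  intros Hu Hv H Hlam Hx D2; apply Rnot_lt_le; intros D3.
  (* As [v x2 <= 1], this factor uses up at most half of the gap at [x2], so the rise survives. *)
  pose (C := 1 + (u (lam * x2) - v x2) / 2).
  assert (Hv2 := profile_nonneg v x2 Hv).
  assert (Hv21 := profile_le_1 v x2 Hv).
  assert (Hv3 := profile_nonneg v x3 Hv).
  apply (H lam C 0 x2 x3); try (unfold C; nra).
  rewrite Rmult_0_r, (proj1 Hu), (proj1 Hv); unfold C; lra.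
Qed.

(** If [u] exceeded [v] at [x], it would still do so after replacing [u] by [u (lam x)] with [lam]
    slightly above [1]. That function vanishes before [1], where [v] is positive, which is a
    forbidden later dip. *)
Lemma profile_le_of_no_dip_rise_dip (u v : R -> R) (x : R) :
  profile u -> profile v -> no_dip_rise_dip (Rle 0) u v ->
  (forall z, z < 1 -> 0 < v z) -> 0 <= x -> u x <= v x.
Proof.
  intros Hu Hv H Hpos Hx; apply Rnot_lt_le; intros Hlt.
  assert (Hx1 : x < 1).
  { apply Rnot_le_lt; intros Hge.
    rewrite (proj1 (proj2 Hu)), (proj1 (proj2 Hv)) in Hlt; lra. }
  destruct (Req_dec x 0) as [->|Hx0].
  { rewrite (proj1 Hu), (proj1 Hv) in Hlt; lra. }
  destruct (proj2 (proj2 (proj2 Hu))) as (L & HL & Hlip).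
  pose (e := (u x - v x) / (2 * L)).
  assert (He : 0 < e) by (apply Rdiv_lt_0_compat; lra).
  assert (Ee : L * e = (u x - v x) / 2) by (unfold e; field; lra).
  pose (lam := 1 + e).
  assert (Hlamx : u x - u (lam * x) <= (u x - v x) / 2).
  { apply Rle_trans with (L * (lam * x - x)); [apply Hlip; unfold lam; nra|].
    rewrite <- Ee; unfold lam; nra. }
  (* A point between [x] and [1] at which the scaled [u] already vanishes. *)
  pose (x3 := Rmax ((1 + x) / 2) (/ lam)).
  assert (Hl : 0 < / lam < 1).
  { split; [apply Rinv_0_lt_compat; unfold lam; lra|].
    rewrite <- Rinv_1; apply Rinv_lt_contravar; unfold lam; lra. }
  assert (Hx31 : x3 < 1) by (apply Rmax_lub_lt; lra).
  assert (Hx32 : (1 + x) / 2 <= x3) by apply Rmax_l.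
  assert (Hx33 : 1 <= lam * x3).
  { rewrite <- (Rinv_r lam) at 1 by (unfold lam; lra).
    apply Rmult_le_compat_l; [unfold lam; lra|apply Rmax_r]. }
  assert (Hc : v x3 <= u (lam * x3)).
  { apply (no_rise_dip u v lam x x3); try assumption; unfold lam in *; lra. }
  rewrite (proj1 (proj2 Hu)) in Hc by assumption.
  specialize (Hpos x3 Hx31); lra.
Qed.

Lemma Top_scaled_ge (f g : R -> R) (x : R) :
  profile (Top f) -> profile (Top g) ->
  0 < RInt (pinv f) 0 1 -> 0 < RInt (pinv g) 0 1 ->
  no_dip_rise_dip (Rle 0) (Top f) (Top g) ->
  (forall z, z < 1 -> 0 < g z) -> 0 <= x ->
  Top g x <= Top f (RInt (pinv f) 0 1 / RInt (pinv g) 0 1 * x).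
Proof.
  intros Hf Hg HA HB H Hpos Hx.
  set (A := RInt (pinv f) 0 1) in *; set (B := RInt (pinv g) 0 1) in *.
  destruct (Req_dec x 0) as [->|Hx0].
  { rewrite Rmult_0_r, (proj1 Hf), (proj1 Hg); lra. }
  set (q := A / B).
  assert (Hq : 0 < q) by now apply Rdiv_lt_0_compat.
  (* Below [q] the scaled [Top f] starts above [Top g]: the slopes at [0]
     are at least [- lam / A] and equal to [- 1 / B], respectively. *)
  assert (Hlam : forall lam, 0 < lam < q -> Top g x <= Top f (lam * x)).
  { intros lam Hlam.
    pose (w := (lam / q + 1) / 2).
    assert (Hlq : 0 < lam / q < 1).
    { split; [apply Rdiv_lt_0_compat; lra|].
      apply Rlt_div_l; lra. }
    assert (Hw : 0 < w < 1 /\ lam / q < w) by (unfold w; lra).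
    assert (Hgw := Hpos w (proj2 (proj1 Hw))).
    (* Up to height [g w] the pseudo-inverse of [g] is at least [w], which exceeds [lam / q]. *)
    pose (x2 := Rmin (g w) (x / 2)).
    assert (Hx2 : 0 < x2) by (apply Rmin_glb_lt; lra).
    assert (Hx2w : x2 <= g w) by apply Rmin_l.
    assert (Hx2x : x2 <= x / 2) by apply Rmin_r.
    apply (no_rise_dip (Top f) (Top g) lam x2 x); try assumption; try lra.
    assert (E1 : 1 - Top f (lam * x2) <= lam * x2 / A).
    { rewrite <- (proj1 Hf), Top_sub; fold A.
      apply Rmult_le_compat_r; [left; now apply Rinv_0_lt_compat|].
      assert (P : 0 < lam * x2) by nra; set (z := lam * x2) in *.
      destruct (RInt_pinv_bounds f 0 z) as [_ K]; [lra|].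
      generalize (pinv_le_1 f 0); nra. }
    assert (E2 : w * x2 / B <= 1 - Top g x2).
    { rewrite <- (proj1 Hg), Top_sub; fold B.
      apply Rmult_le_compat_r; [left; now apply Rinv_0_lt_compat|].
      destruct (RInt_pinv_bounds g 0 x2) as [K _]; [lra|].
      assert (w <= pinv g x2) by (apply pinv_ge; lra).
      nra. }
    assert (E3 : lam * x2 / A = lam / q * x2 / B)
      by (unfold q; field; lra).
    assert (E4 : lam / q * x2 / B < w * x2 / B).
    { apply Rmult_lt_compat_r; [now apply Rinv_0_lt_compat|nra]. }
    lra. }
  (* The factor [q] itself is reached by letting [lam] tend to [q]: a [lam] within [d / 2] of [q]
     costs at most half of the supposed gap. *)
  apply Rnot_lt_le; intros Hlt.
  destruct (proj2 (proj2 (proj2 Hf))) as (L & HL & Hlip).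
  pose (d := (Top g x - Top f (q * x)) / (L * x)).
  assert (Hd : 0 < d) by (apply Rdiv_lt_0_compat; nra).
  pose (lam := Rmax (q / 2) (q - d / 2)).
  assert (Hl1 : q / 2 <= lam) by apply Rmax_l.
  assert (Hl2 : q - d / 2 <= lam) by apply Rmax_r.
  assert (Hl3 : lam < q) by (apply Rmax_lub_lt; lra).
  assert (K1 := Hlam lam ltac:(lra)).
  assert (K2 := Hlip (lam * x) (q * x) ltac:(nra)).
  assert (K3 : L * x * d = Top g x - Top f (q * x)) by (unfold d; field; lra).
  assert (0 < L * x) by nra.
  assert (L * (q * x - lam * x) <= L * x * (d / 2)) by nra.
  lra.
Qed.

(** * Scaling inequalities for pseudo-inverses and their integrals *)

(** Multiplication by [q] maps superlevel sets of [v] into those of [u], and [q <= 1] keeps them in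
    [[0,1]]. *)
Lemma pinv_scaled_ge (u v : R -> R) (q y : R) :
  0 <= q <= 1 -> (forall x, 0 <= x -> v x <= u (q * x)) ->
  q * pinv v y <= pinv u y.
Proof.
  intros Hq H; destruct (Req_dec q 0) as [->|Hq0].
  { rewrite Rmult_0_l; apply pinv_nonneg. }
  apply Rmult_le_reg_l with (/ q); [apply Rinv_0_lt_compat; lra|].
  rewrite <- Rmult_assoc, Rinv_l, Rmult_1_l by assumption.
  apply pinv_le.
  - apply Rmult_le_pos; [left; apply Rinv_0_lt_compat; lra|apply pinv_nonneg].
  - intros x Hx Hy; apply Rmult_le_reg_l with q; [lra|].
    rewrite <- Rmult_assoc, Rinv_r, Rmult_1_l by assumption.
    apply pinv_ge; [nra|]; specialize (H x (proj1 Hx)); lra.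
Qed.

Lemma RInt_pinv_scaled_ge (u v : R -> R) (q a b : R) : a <= b ->
  (forall y, q * pinv v y <= pinv u y) ->
  q * RInt (pinv v) a b <= RInt (pinv u) a b.
Proof.
  intros Hab H.
  replace (q * RInt (pinv v) a b) with (RInt (fun y => q * pinv v y) a b)
    by (apply (@RInt_scal R_CompleteNormedModule), ex_RInt_pinv).
  apply RInt_le; [assumption| |apply ex_RInt_pinv|intros; apply H].
  apply (@ex_RInt_scal R_NormedModule), ex_RInt_pinv.
Qed.

(** * The invariant of the iteration and the ratio of integrals *)

(** The sign condition is put on the pseudo-inverses so that the starting pair qualifies: [h0] is
    not a profile, and [f] may jump. *)
Definition comparable (f g : R -> R) : Prop :=
  (forall x, 0 <= x <= 1 -> f x <= g x <= 1) /\
  (forall x, x < 1 -> 0 < g x) /\ (forall y, y < 1 -> 0 < pinv g y) /\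
  0 < RInt (pinv f) 0 1 /\ no_dip_rise_dip (Rlt 0) (pinv f) (pinv g).

Definition ratio (f g : R -> R) : R := RInt (pinv f) 0 1 / RInt (pinv g) 0 1.

Lemma comparable_RInt_pos (f g : R -> R) :
  comparable f g -> 0 < RInt (pinv g) 0 1.
Proof.
  intros (_ & _ & Hp & _); apply RInt_pinv_pos with (1 / 2); [lra|].
  apply Hp; lra.
Qed.

Lemma comparable_ratio (f g : R -> R) : comparable f g -> 0 < ratio f g <= 1.
Proof.
  intros Hfg; assert (HB := comparable_RInt_pos f g Hfg).
  destruct Hfg as (Hle & _ & _ & HA & _); unfold ratio; split.
  - now apply Rdiv_lt_0_compat.
  - apply Rle_div_l; [assumption|]; rewrite Rmult_1_l.
    apply RInt_le; [lra|apply ex_RInt_pinv|apply ex_RInt_pinv|].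
    intros y _; apply pinv_le; [apply pinv_nonneg|].
    intros x Hx Hy; apply pinv_ge; [assumption|].
    specialize (Hle x Hx); lra.
Qed.

Lemma comparable_profile (f g : R -> R) : comparable f g ->
  profile (Top f) /\ profile (Top g) /\
  no_dip_rise_dip (Rle 0) (Top f) (Top g).
Proof.
  intros Hfg; assert (HB := comparable_RInt_pos f g Hfg).
  destruct Hfg as (Hle & _ & _ & HA & Hno).
  assert (Pf : profile (Top f)).
  { apply profile_Top; [|assumption]; intros x Hx; specialize (Hle x Hx); lra. }
  assert (Pg : profile (Top g)).
  { apply profile_Top; [|assumption]; intros x Hx; specialize (Hle x Hx); lra. }
  split; [assumption|split; [assumption|]].
  now apply no_dip_rise_dip_Top.
Qed.

(** The order of the images comes from the sign pattern, since the two normalising integrals may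
    differ. *)
Lemma comparable_Top (f g : R -> R) :
  comparable f g -> comparable (Top f) (Top g).
Proof.
  intros Hfg; assert (HB := comparable_RInt_pos f g Hfg).
  destruct (comparable_profile f g Hfg) as (Pf & Pg & Hno).
  destruct Hfg as (_ & _ & Hp & _).
  assert (Hpos : forall x, x < 1 -> 0 < Top g x)
    by (intros x; now apply Top_pos).
  split; [|split; [|split; [|split]]].
  - intros x Hx; split.
    + now apply profile_le_of_no_dip_rise_dip.
    + now apply profile_le_1.
  - assumption.
  - intros y; now apply profile_pinv_pos.
  - now apply profile_RInt_pinv_pos.
  - now apply no_dip_rise_dip_pinv.
Qed.

Lemma comparable_pinv_Top (f g : R -> R) (y : R) : comparable f g ->
  ratio f g * pinv (Top g) y <= pinv (Top f) y.
Proof.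
  intros Hfg; assert (HB := comparable_RInt_pos f g Hfg).
  assert (Hq := comparable_ratio f g Hfg).
  destruct (comparable_profile f g Hfg) as (Pf & Pg & Hno).
  destruct Hfg as (_ & Hpos & _ & HA & _).
  apply pinv_scaled_ge; [lra|].
  intros x Hx; now apply Top_scaled_ge.
Qed.

Lemma ratio_Top_ge (f g : R -> R) :
  comparable f g -> ratio f g <= ratio (Top f) (Top g).
Proof.
  intros Hfg.
  assert (HB := comparable_RInt_pos _ _ (comparable_Top _ _ Hfg)).
  unfold ratio at 2; apply -> Rle_div_r; [|assumption].
  apply RInt_pinv_scaled_ge; [lra|].
  intros y; now apply comparable_pinv_Top.
Qed.

(** The bound on pseudo-inverses is integrated over [[x,1]]; the ratio in the denominator converts
    one normalisation into the other. *)
Lemma Top_Top_ge (f g : R -> R) (x : R) : comparable f g -> 0 <= x <= 1 ->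
  ratio f g / ratio (Top f) (Top g) * Top (Top g) x <= Top (Top f) x.
Proof.
  intros Hfg Hx; assert (Hfg' := comparable_Top _ _ Hfg).
  assert (HB := comparable_RInt_pos _ _ Hfg').
  assert (HA := proj1 (proj2 (proj2 (proj2 Hfg')))).
  assert (H := RInt_pinv_scaled_ge (Top f) (Top g) (ratio f g) x 1 (proj2 Hx)
                 (fun y => comparable_pinv_Top f g y Hfg)).
  unfold ratio at 2; unfold Top at 3 5; unfold Iop.
  apply -> Rle_div_r; [|assumption].
  eapply Rle_trans; [right|exact H].
  field; lra.
Qed.

(** * The starting pair and the convergence *)

(** Up to [1] the pseudo-inverse of [h0] is constant, so a decreasing function cannot rise above a
    multiple of it after a dip. *)
Lemma comparable_h0 (f : R -> R) : inE f -> comparable f h0.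
Proof.
  intros (Hf0 & Hfm & Hf1 & HfI).
  assert (Hh : forall y, y <= 1 -> pinv h0 y = 1).
  { intros y Hy; apply Rle_antisym; [apply pinv_le_1|].
    apply pinv_ge; unfold h0; lra. }
  split; [|split; [|split; [|split]]].
  - intros x Hx; unfold h0; rewrite <- Hf1; split; [apply Hfm|]; lra.
  - intros x _; unfold h0; lra.
  - intros y Hy; rewrite Hh; lra.
  (* A value [f x > 0] with [x > 0] gives [pinv f (f x) >= x], hence a positive integral; otherwise
     [f] would have integral [0]. *)
  - apply NNPP; intros HA; apply (Rlt_irrefl 0).
    replace 0 with (RInt f 0 1) at 2; [assumption|].
    rewrite (RInt_ext _ (fun _ => 0)).
    + rewrite RInt_const; unfold scal; simpl; unfold mult; simpl; ring.
    + rewrite Rmin_left, Rmax_right by lra.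
      intros x Hx; apply Rle_antisym; [|apply Hf0; lra].
      apply Rnot_lt_le; intros Hfx; apply HA.
      assert (f x <= 1) by (rewrite <- Hf1; apply Hfm; lra).
      apply RInt_pinv_pos with (f x); [lra|].
      apply Rlt_le_trans with x; [lra|apply pinv_ge; lra].
  - intros lam C y1 y2 y3 Hlam HC Hy1 H12 H23 D1 D2 D3.
    assert (Hy3 : y3 <= 1).
    { apply Rnot_lt_le; intros Hgt.
      rewrite (pinv_eq_0 h0 y3) in D3 by (intros; unfold h0; lra).
      generalize (pinv_nonneg f (lam * y3)); lra. }
    rewrite Hh in D1, D2 by lra.
    generalize (pinv_antitone f (lam * y1) (lam * y2)); nra.
Qed.

Lemma comparable_iter (f : R -> R) (n : nat) : inE f ->
  comparable (Nat.iter n Top f) (Nat.iter n Top h0).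
Proof.
  intros Hf; induction n as [|n IH]; [now apply comparable_h0|].
  now apply comparable_Top.
Qed.

Theorem theorem4p11 (h : R -> R)
  (Hh : unif_conv01 (fun n => Nat.iter n Top h0) h)
  (f : R -> R) (Hf : inE f) :
  unif_conv01 (fun n => Nat.iter n Top f) h.
Proof.
  intros eps Heps.
  pose (q := fun n => ratio (Nat.iter n Top f) (Nat.iter n Top h0)).
  assert (Hcmp := fun n => comparable_iter f n Hf).
  assert (Hq : forall n, 0 < q n <= 1) by
    exact (fun n => comparable_ratio _ _ (Hcmp n)).
  assert (Hinc : forall n, q n <= q (S n)) by
    exact (fun n => ratio_Top_ge _ _ (Hcmp n)).
  assert (Hq0 : forall n, q O <= q n).
  { induction n as [|n IH]; [lra|]; specialize (Hinc n); lra. }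
  destruct (ex_finite_lim_seq_incr q 1 Hinc (fun n => proj2 (Hq n))) as [l Hl].
  (* Late consecutive ratios then differ by less than [q O * (eps / 2)]; dividing by
     [q (S n) >= q O] puts their quotient within [eps / 2] of [1]. *)
  assert (He : 0 < q O * (eps / 4)) by (specialize (Hq O); nra).
  apply is_lim_seq_spec in Hl.
  destruct (Hl (mkposreal _ He)) as [N1 HN1]; simpl in HN1.
  destruct (Hh (eps / 2)) as [N2 HN2]; [lra|].
  exists (N1 + N2 + 2)%nat; intros n Hn x Hx.
  destruct n as [|[|n]]; [lia|lia|].
  specialize (HN2 (S (S n)) ltac:(lia) x Hx).
  assert (K1 := HN1 n ltac:(lia)); assert (K2 := HN1 (S n) ltac:(lia)).
  assert (Hge := Top_Top_ge _ _ x (Hcmp n) Hx).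
  destruct (proj1 (Hcmp (S (S n))) x Hx) as [Hle Hle1].
  change (ratio (Nat.iter n Top f) (Nat.iter n Top h0)) with (q n) in Hge.
  change (ratio (Top (Nat.iter n Top f)) (Top (Nat.iter n Top h0)))
    with (q (S n)) in Hge.
  change (Top (Top (Nat.iter n Top f))) with (Nat.iter (S (S n)) Top f) in Hge.
  change (Top (Top (Nat.iter n Top h0)))
    with (Nat.iter (S (S n)) Top h0) in Hge.
  set (u := Nat.iter (S (S n)) Top f x) in *.
  set (v := Nat.iter (S (S n)) Top h0 x) in *.
  apply Rabs_def2 in K1; apply Rabs_def2 in K2; apply Rabs_def2 in HN2.
  assert (Hr : 1 - eps / 2 < q n / q (S n)).
  { apply Rlt_div_r; [apply Hq|].
    specialize (Hq0 (S n)); nra. }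
  assert (Hr1 : q n / q (S n) <= 1).
  { apply Rle_div_l; [apply Hq|]; specialize (Hinc n); lra. }
  (* As [v <= 1], the gap is at most one minus the quotient of ratios; the other [eps / 2] is the
     distance from [v] to [h x]. *)
  assert (v - u < eps / 2) by nra.
  apply Rabs_def1; lra.
Qed.
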